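(* (a) If $f\in\mathcal{L}^1_{loc}(G)$ is a Meyer almost periodic function, then $f$ is a Weyl almost periodic function. (b) If $\mu$ is a translation bounded measure on $G$ which is Meyer almost periodic, then $\mu$ is a Weyl almost periodic measure.
   Context: $G$ is a locally compact (Hausdorff), $\sigma$-compact abelian group with Haar measure $\theta_G$; $|A|=\theta_G(A)$, and $\mathrm{d}t$ denotes integration against $\theta_G$. A measure $\mu$ is translation bounded if $\sup_{t\in G}|\mu|(t+V)<\infty$ for one (equivalently every) nonempty open relatively compact $V$; $(\mu*\varphi)(t)=\int_G\varphi(t-s)\,\mathrm{d}\mu(s)$ for $\varphi\in C_c(G)$. A van Hove sequence $\mathcal{A}=(A_n)$ is a sequence of relatively compact open sets (of positive measure) with $|\partial^K A_n|/|A_n|\to 0$ for every compact $K\subseteq G$, where $\partial^K A=\big(\overline{A+K}\cap\overline{A^c}\big)\cup\big(\overline{A^c-K}\cap\overline{A}\big)$. For $f\in\mathcal{L}^1_{loc}(G)$ put $\|f\|_{\mathsf{W},1,\mathcal{A}}=\limsup_n\sup_{x\in G}\frac{1}{|A_n|}\int_{x+A_n}|f(t)|\,\mathrm{d}t$. For bounded functions the value of this seminorm does not depend on $\mathcal{A}$ when it is $0$. A function $f\in\mathcal{L}^1_{loc}(G)$ is Weyl almost periodic with respect to $\mathcal{A}$ if for each $\varepsilon>0$ there is a trigonometric polynomial $P$ (finite linear combination of continuous characters) with $\|f-P\|_{\mathsf{W},1,\mathcal{A}}<\varepsilon$; a measure $\mu$ is Weyl almost periodic if all $\mu*\varphi$,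 $\varphi\in C_c(G)$, are. For bounded functions and for translation bounded measures these notions do not depend on the van Hove sequence $\mathcal{A}$. A Bohr almost periodic function is a uniform limit of trigonometric polynomials; it has a mean $M(f)=\lim_n\frac{1}{|A_n|}\int_{A_n}f(t)\,\mathrm{d}t$ independent of $\mathcal{A}$. A function $f:G\to\mathbb{R}$ is generalized almost periodic (g-a-p) if it is measurable and for each $\varepsilon>0$ there are real-valued Bohr almost periodic functions $g,h$ with $g\le f\le h$ and $M(h-g)<\varepsilon$; a complex-valued function is g-a-p if its real and imaginary parts are. A function $f:G\to\mathbb{C}$ is Meyer almost periodic if $f=g+h$ with $g$ g-a-p and $h$ bounded (measurable) with $\|h\|_{\mathsf{W},1,\mathcal{A}}=0$. A translation bounded measure $\mu$ is Meyer almost periodic if $\mu*\varphi$ is a Meyer almost periodic function for all $\varphi\in C_c(G)$. *)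

(* Defs.v *)
From HB Require Import structures.
From mathcomp Require Import all_boot all_order all_algebra.
From mathcomp Require Import complex.
From mathcomp Require Import all_classical all_reals all_analysis.

Set Implicit Arguments.
Unset Strict Implicit.
Unset Printing Implicit Defensive.

Import Order.TTheory GRing.Theory Num.Theory.
Import numFieldTopology.Exports.
Import numFieldNormedType.Exports.

Local Open Scope classical_set_scope.
Local Open Scope ring_scope.

(* [borel G] is [G] itself, carrying the sigma-algebra generated by the open
   sets.  The alias is needed because MathComp-Analysis asks measurable types
   to be pointed, which a topologicalZmodType is not; the point is 0. *)
Definition borel (G : topologicalZmodType) : Type := G.

Section BorelInstance.
Variable G : topologicalZmodType.

HB.instance Definition _ := Choice.on (borel G).
HB.instance Definition _ := isPointed.Build (borel G) (0 : G).

Let opens : set (set (borel G)) := @open G.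

HB.instance Definition _ := @isMeasurable.Build (sigma_display opens)
  (borel G) <<s opens >> (@sigma_algebra0 _ setT opens)
  (@sigma_algebraC (borel G) opens) (@sigma_algebra_bigcup _ setT opens).

End BorelInstance.

Definition sigma_compact (G : topologicalType) : Prop :=
  exists2 K : (set G)^nat, (forall n, compact (K n)) & \bigcup_n K n = setT.

Definition set_add (G : zmodType) (A B : set G) : set G :=
  [set a + b | a in A & b in B].

Definition set_sub (G : zmodType) (A B : set G) : set G :=
  [set a - b | a in A & b in B].

Definition translate (G : zmodType) (x : G) (A : set G) : set G :=
  [set x + a | a in A].

Section HaarMeasure.
Variables (R : realType) (G : topologicalZmodType).
Variable theta : {measure set (borel G) -> \bar R}.

(* A nonzero translation invariant Radon measure. *)
Record haar_measure : Prop := HaarMeasure {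
  haar_invariant : forall (x : G) (B : set (borel G)), measurable B ->
    theta (translate x B) = theta B;
  haar_compact : forall K : set G, compact K -> (theta K < +oo)%E;
  haar_outer_regular : forall B : set (borel G), measurable B ->
    theta B = ereal_inf [set theta U | U in [set U : set G |
                                             open U /\ B `<=` U]];
  haar_inner_regular : forall U : set G, open U ->
    theta U = ereal_sup [set theta K | K in [set K : set G |
                                             compact K /\ K `<=` U]];
  haar_neq0 : theta setT != 0%E
}.

Definition van_hove_boundary (K A : set G) : set G :=
  (closure (set_add A K) `&` closure (~` A)) `|`
  (closure (set_sub (~` A) K) `&` closure A).

Record van_hove (A : (set G)^nat) : Prop := VanHove {
  van_hove_open : forall n, open (A n);
  van_hove_precompact : forall n, precompact (A n);
  van_hove_gt0 : forall n, (0 < theta (A n))%E;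
  van_hove_cvg : forall K : set G, compact K ->
    (theta (van_hove_boundary K (A n)) / theta (A n))%E @[n --> \oo] --> 0%E
}.

End HaarMeasure.

Notation modulus := (@ComplexField.Normc.normc _).

Section ComplexFunctions.
Variables (R : realType) (G : topologicalZmodType).
Implicit Types f phi chi P : G -> R[i].

(* The regular module [R[i]^o] is what carries the topology of the modulus. *)
Definition ccontinuous f : Prop := continuous (f : G -> R[i]^o).

(* Borel measurability for the product structure of C = R x R. *)
Definition cmeasurable f : Prop :=
  measurable_fun [set: borel G] (fun t : borel G => complex.Re (f t)) /\
  measurable_fun [set: borel G] (fun t : borel G => complex.Im (f t)).

Definition csupport f : set G := closure [set t | f t != 0].

Definition Cc f : Prop := ccontinuous f /\ compact (csupport f).

Definition sup_norm f : R := sup [set modulus (f t) | t in [set: G]].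

Record character chi : Prop := Character {
  character_continuous : ccontinuous chi;
  character_modulus : forall t, modulus (chi t) = 1;
  character_add : forall s t, chi (s + t) = chi s * chi t
}.

Definition trig_poly P : Prop :=
  exists n (c : 'I_n -> R[i]) (chi : 'I_n -> G -> R[i]),
    (forall i, character (chi i)) /\
    (forall t, P t = \sum_(i < n) c i * chi i t).

Definition bohr_ap f : Prop :=
  forall eps : R, 0 < eps -> exists2 P, trig_poly P &
    forall t, modulus (f t - P t) <= eps.

Definition real_bohr_ap (g : G -> R) : Prop :=
  bohr_ap (fun t => Complex (g t) 0).

End ComplexFunctions.

Section AlmostPeriodicFunctions.
Variables (R : realType) (G : topologicalZmodType).
Variable theta : {measure set (borel G) -> \bar R}.
Variable A : (set G)^nat.
Implicit Types f g h : G -> R[i].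

Definition L1_loc f : Prop :=
  cmeasurable f /\
  forall K : set G, compact K ->
    (\int[theta]_(t in K) (modulus (f t))%:E < +oo)%E.

Definition weyl_norm f : \bar R :=
  limn_esup (fun n => ereal_sup
    [set (\int[theta]_(t in translate x (A n)) (modulus (f t))%:E
          / theta (A n))%E | x in [set: G]]).

Definition weyl_ap f : Prop :=
  L1_loc f /\
  forall eps : R, 0 < eps -> exists2 P, trig_poly P &
    (weyl_norm (fun t => (f t - P t)%R) < eps%:E)%E.

(* The mean of a real-valued function; the limit exists when the function is
   Bohr almost periodic, the only case in which [mean] is used. *)
Definition mean (f : G -> R) : R :=
  limn (fun n => Rintegral theta (A n) f / fine (theta (A n))).

Definition real_gap (f : G -> R) : Prop :=
  measurable_fun [set: borel G] (f : borel G -> R) /\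
  forall eps : R, 0 < eps -> exists g h : G -> R,
    [/\ real_bohr_ap g, real_bohr_ap h, (forall t, g t <= f t <= h t)
      & mean (fun t => h t - g t) < eps].

Definition gap f : Prop :=
  real_gap (fun t => complex.Re (f t)) /\ real_gap (fun t => complex.Im (f t)).

Definition meyer_ap f : Prop :=
  exists g h, [/\ (forall t, f t = g t + h t), gap g, cmeasurable h,
    (exists M : R, forall t, modulus (h t) <= M) & weyl_norm h = 0%E].

End AlmostPeriodicFunctions.

Section Measures.
Variables (R : realType) (G : topologicalZmodType).
Implicit Types (mu : (G -> R[i]) -> R[i]) (phi psi : G -> R[i]).

(* A (complex Radon) measure on G is a linear functional on C_c(G) which is
   continuous on the functions supported in any given compact set; [mu phi] is
   the integral of phi against mu.  Only the values of [mu] on C_c(G) matter: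
   all the definitions below evaluate it there. *)
Record radon_measure mu : Prop := RadonMeasure {
  radon_linear : forall (a : R[i]) phi psi, Cc phi -> Cc psi ->
    mu (fun t => a * phi t + psi t) = a * mu phi + mu psi;
  radon_bounded : forall K : set G, compact K ->
    exists C : R, forall phi, Cc phi -> csupport phi `<=` K ->
      modulus (mu phi) <= C * sup_norm phi
}.

(* |mu|(U) for U open: the supremum of |mu(phi)| over the phi in C_c(G) with
   |phi| <= 1_U. *)
Definition radon_variation mu (U : set G) : \bar R :=
  ereal_sup [set (modulus (mu phi))%:E | phi in [set phi |
    Cc phi /\ forall t, modulus (phi t) <= \1_U t]].

Definition translation_bounded mu : Prop :=
  exists V : set G, [/\ V !=set0, open V, precompact V &
    (ereal_sup [set radon_variation mu (translate t V) | t in [set: G]]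
     < +oo)%E].

Definition convolution mu phi : G -> R[i] :=
  fun t => mu (fun s => phi (t - s)).

Variable theta : {measure set (borel G) -> \bar R}.
Variable A : (set G)^nat.

Definition weyl_ap_measure mu : Prop :=
  forall phi, Cc phi -> weyl_ap theta A (convolution mu phi).

Definition meyer_ap_measure mu : Prop :=
  forall phi, Cc phi -> meyer_ap theta A (convolution mu phi).

End Measures.

(* Main.v *)
(* Translating the van Hove sets changes the averages of a bounded function by
   a vanishing amount; since the translate by s multiplies the average of a
   character chi by chi(s), the averages of chi over x + A_n tend to a mean
   uniformly in x.  This passes to trigonometric polynomials and to their
   uniform limits.  Hence, for a real g-a-p function u between Bohr almost
   periodic functions g <= u <= h, the Weyl seminorm of u - g is at most
   M(h - g), and a trigonometric polynomial uniformly close to g approximates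
   u in the Weyl seminorm.  A Meyer almost periodic function is automatically
   bounded and measurable, hence locally integrable, so the statement about
   measures reduces to the one about functions. *)

Require Import Defs.
From mathcomp Require Import all_boot all_order all_algebra.
From mathcomp Require Import complex.
From mathcomp Require Import all_classical all_reals all_analysis.
From mathcomp Require Import measurable_realfun ring lra.

Set Implicit Arguments.
Unset Strict Implicit.
Unset Printing Implicit Defensive.

Import Order.TTheory GRing.Theory Num.Theory.
Import numFieldTopology.Exports.
Import numFieldNormedType.Exports.

Local Open Scope classical_set_scope.
Local Open Scope ring_scope.

(** * The real-valued modulus on the complex numbers *)

Section ComplexModulus.
Variable R : realType.
Implicit Types z w : R[i].

Lemma normr_modulus z : `|z| = (modulus z)%:C%C.
Proof. by case: z. Qed.

Lemma modulus_ge0 z : 0 <= modulus z.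
Proof. by case: z => a b; exact: sqrtr_ge0. Qed.

Lemma modulusN z : modulus (- z) = modulus z.
Proof. by case: z => a b /=; rewrite !sqrrN. Qed.

Lemma ler_Re_modulus z : `|complex.Re z| <= modulus z.
Proof.
by case: z => a b /=; rewrite -sqrtr_sqr ler_wsqrtr// lerDl sqr_ge0.
Qed.

Lemma ler_Im_modulus z : `|complex.Im z| <= modulus z.
Proof.
by case: z => a b /=; rewrite -sqrtr_sqr ler_wsqrtr// lerDr sqr_ge0.
Qed.

Lemma ler_modulusD z w : modulus (z + w) <= modulus z + modulus w.
Proof.
by rewrite -lecR rmorphD/= -!normr_modulus ler_normD.
Qed.

Lemma ler_modulus_ReIm z :
  modulus z <= `|complex.Re z| + `|complex.Im z|.
Proof.
case: z => a b /=; rewrite -[leRHS]ger0_norm ?addr_ge0// -sqrtr_sqr.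
rewrite ler_wsqrtr// sqrrD !real_normK ?num_real//.
by rewrite addrAC lerDl mulrn_wge0// mulr_ge0.
Qed.

End ComplexModulus.

(** * Borel measurability of continuous functions *)

Section BorelMeasurability.
Variables (R : realType) (G : topologicalZmodType).

Lemma open_borel (U : set G) : open U -> measurable (U : set (borel G)).
Proof. exact: sub_sigma_algebra. Qed.

Lemma closed_borel (K : set G) : closed K -> measurable (K : set (borel G)).
Proof.
by move=> clK; rewrite -[K]setCK; apply: measurableC; apply: open_borel;
  rewrite openC.
Qed.

Lemma measurable_continuous (u : G -> R) : continuous u ->
  measurable_fun [set: borel G] (u : borel G -> R).
Proof.
move=> cu; apply: (measurability _ (RGenOInfty.measurableE R)).
move=> _ [_ [x ->]] <-; rewrite setTI; apply: open_borel.
by apply: open_comp => // t _; exact: cu.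
Qed.

(** Serves for [p] the real or the imaginary part. Continuity of [f] is tested against the
    complex-valued norm, so the real radius is first embedded into [R[i]]. *)
Lemma lipschitz_continuous_comp (f : G -> R[i]) (p : R[i] -> R) :
  (forall z w, `|p z - p w| <= modulus (z - w)) -> ccontinuous f ->
  continuous (p \o f).
Proof.
move=> lip cf t; apply/cvgrPdist_lt => e e0.
have e0' : (0 : R[i]) < e%:C%C by rewrite ltcR.
move/cvgrPdist_lt: (cf t) => /(_ _ e0'); apply: filterS => s.
by rewrite /= normr_modulus ltcR; apply: le_lt_trans.
Qed.

Lemma ccontinuous_measurable (f : G -> R[i]) :
  ccontinuous f -> cmeasurable f.
Proof.
move=> cf; split; apply: measurable_continuous.
  apply: (@lipschitz_continuous_comp f (@complex.Re R)) cf => z w.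
  by rewrite -raddfB ler_Re_modulus.
apply: (@lipschitz_continuous_comp f (@complex.Im R)) cf => z w.
by rewrite -raddfB ler_Im_modulus.
Qed.

Lemma cmeasurableD (f g : G -> R[i]) :
  cmeasurable f -> cmeasurable g -> cmeasurable (fun t => f t + g t).
Proof.
by move=> [fr fi] [gr gi]; split; under eq_fun do rewrite raddfD;
  apply: measurable_funD.
Qed.

Lemma cmeasurable_modulus (f : G -> R[i]) : cmeasurable f ->
  measurable_fun [set: borel G] (fun t : borel G => modulus (f t)).
Proof.
move=> [fr fi].
rewrite (_ : (fun _ => _) = (fun t => Num.sqrt (complex.Re (f t) ^+ 2
    + complex.Im (f t) ^+ 2))); last first.
  by apply/funext => t; case: (f t).
apply: (@measurableT_comp _ _ _ _ _ _ (@Num.sqrt R)).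
  by apply: continuous_measurable_fun; exact: sqrt_continuous.
by apply: measurable_funD; apply: measurable_funX.
Qed.

End BorelMeasurability.

(** * Bounded Borel functions and translations *)

Section BoundedMeasurable.
Variables (R : realType) (G : topologicalZmodType).
Implicit Types u v : G -> R.

(** These functions are integrable on every Borel set of finite measure. The class is stable under
    linear operations, absolute values and shifts, so it supplies every integrability side condition
    on averages. *)
Definition bounded_measurable u : Prop :=
  measurable_fun [set: borel G] (u : borel G -> R) /\
  exists M, forall t, `|u t| <= M.

Lemma bounded_measurable_cst (c : R) : bounded_measurable (fun=> c).
Proof. by split=> //; exists `|c|. Qed.

Lemma bounded_measurableD u v : bounded_measurable u -> bounded_measurable v ->
  bounded_measurable (fun t => u t + v t).
Proof.
move=> [mu [M uM]] [mv [N vN]]; split; first exact: measurable_funD.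
by exists (M + N) => t; rewrite (le_trans (ler_normD _ _))// lerD.
Qed.

Lemma bounded_measurableZ (c : R) u : bounded_measurable u ->
  bounded_measurable (fun t => c * u t).
Proof.
move=> [mu [M uM]]; split; first exact: measurable_funM.
by exists (`|c| * M) => t; rewrite normrM ler_wpM2l.
Qed.

Lemma bounded_measurableB u v : bounded_measurable u -> bounded_measurable v ->
  bounded_measurable (fun t => u t - v t).
Proof.
move=> bu /(bounded_measurableZ (-1)) bv.
by under eq_fun do rewrite -mulN1r; exact: bounded_measurableD.
Qed.

Lemma bounded_measurable_norm u : bounded_measurable u ->
  bounded_measurable (fun t => `|u t|).
Proof.
move=> [mu [M uM]]; split; first exact: measurableT_comp.
by exists M => t; rewrite normr_id.
Qed.

Lemma continuous_addl (x : G) : continuous (fun t : G => x + t).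
Proof.
move=> t; apply: (@cvg_comp _ _ _ (fun s : G => (x, s))
  (fun p : G * G => p.1 + p.2) _ (nbhs (x, t))).
  by apply: cvg_pair; [exact: cvg_cst|exact: cvg_id].
exact: (@tvs.add_continuous G (x, t)).
Qed.

Lemma measurable_addl (x : G) :
  measurable_fun [set: borel G] ((fun t : G => x + t) : borel G -> borel G).
Proof.
apply: (@measurability _ _ (borel G) (borel G) _ _ (@open G)) => //.
move=> _ [U oU <-]; rewrite setTI; apply: open_borel.
by apply: open_comp => // t _; exact: continuous_addl.
Qed.

Lemma bounded_measurable_shift x u : bounded_measurable u ->
  bounded_measurable (fun t => u (x + t)).
Proof.
move=> [mu [M uM]]; split; last by exists M.
exact: (measurableT_comp mu (measurable_addl x)).
Qed.

(** In preimage form, measurability of a translate follows from that of the opposite translation. *)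
Lemma translateE x (B : set G) : translate x B = (fun t => - x + t) @^-1` B.
Proof.
apply/seteqP; split=> [_ [b Bb <-]|t Bt] /=; first by rewrite addKr.
by exists (- x + t); rewrite ?addNKr// addrA subrr add0r.
Qed.

Lemma preimage_translate x (B : set G) :
  (fun t => x + t) @^-1` translate x B = B.
Proof. by rewrite translateE; apply/seteqP; split=> t /=; rewrite addKr. Qed.

Lemma measurable_translate x (B : set G) : measurable (B : set (borel G)) ->
  measurable (translate x B : set (borel G)).
Proof.
rewrite translateE => mB; rewrite -[X in measurable X]setTI.
exact: measurable_addl.
Qed.

End BoundedMeasurable.

(** * Change of variables for Haar measure *)

Section HaarIntegral.
Variables (R : realType) (G : topologicalZmodType).
Variable theta : {measure set (borel G) -> \bar R}.
Hypothesis theta_haar : haar_measure theta.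
Implicit Types u v : G -> R.

Lemma bounded_measurable_integrable u (B : set G) :
  measurable (B : set (borel G)) -> (theta B < +oo)%E ->
  bounded_measurable u -> theta.-integrable B (EFin \o u).
Proof.
move=> mB Bfin [mu [M uM]]; apply: measurable_bounded_integrable => //.
  exact: measurable_funTS.
exists M; split; first exact: num_real.
by move=> N MN t _ /=; rewrite (le_trans (uM t))// ltW.
Qed.

(** By invariance [theta] is its own pushforward under the translation by [x], so this is the change
    of variables formula. The nonnegative version serves the Weyl seminorm; the real version below
    serves signed functions. *)
Lemma integral_translate x (B : set G) (f : G -> \bar R) :
  measurable (B : set (borel G)) ->
  measurable_fun [set: borel G] (f : borel G -> \bar R) ->
  (forall t, 0 <= f t)%E ->
  (\int[theta]_(t in translate x B) f t = \int[theta]_(t in B) f (x + t)%R)%E.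
Proof.
move=> mB mf f0; have mxB := measurable_translate x mB.
transitivity (\int[pushforward theta ((fun t : G => (x + t)%R)
    : borel G -> borel G)]_(t in translate x B) f t)%E.
  apply: eq_measure_integral; first exact: measurable_addl.
  move=> ? C mC _.
  by rewrite /= /pushforward -(haar_invariant theta_haar (- x) mC) translateE opprK.
rewrite ge0_integral_pushforward//.
- by rewrite preimage_translate.
- exact: measurable_addl.
- exact: measurable_funTS.
Qed.

Lemma Rintegral_translate x (B : set G) u :
  measurable (B : set (borel G)) -> (theta B < +oo)%E ->
  bounded_measurable u ->
  (\int[theta]_(t in translate x B) u t = \int[theta]_(t in B) u (x + t))%R.
Proof.
move=> mB Bfin bu; have mxB := measurable_translate x mB.
have [mu _] := bu.
rewrite /Rintegral; congr fine.
transitivity (\int[pushforward theta ((fun t : G => (x + t)%R)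
    : borel G -> borel G)]_(t in translate x B) (u t)%:E)%E.
  apply: eq_measure_integral; first exact: measurable_addl.
  move=> ? C mC _.
  by rewrite /= /pushforward -(haar_invariant theta_haar (- x) mC) translateE opprK.
rewrite integral_pushforward//.
- by rewrite preimage_translate.
- exact: measurable_addl.
- exact/measurable_EFinP.
- rewrite preimage_translate; apply: bounded_measurable_integrable => //.
  exact: bounded_measurable_shift.
Qed.

End HaarIntegral.

(** * Averages over translated van Hove sets *)

Section Averages.
Variables (R : realType) (G : topologicalZmodType).
Variable theta : {measure set (borel G) -> \bar R}.
Hypothesis theta_haar : haar_measure theta.
Variable A : nat -> set G.
Hypothesis A_van_hove : van_hove theta A.
Implicit Types (u v : G -> R) (f P chi : G -> R[i]).

Local Notation a n := (fine (theta (A n))).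

Let measurable_A n : measurable (A n : set (borel G)).
Proof. by apply: open_borel; exact: (van_hove_open A_van_hove). Qed.

Lemma van_hove_fin n : (theta (A n) < +oo)%E.
Proof.
have := van_hove_precompact A_van_hove n; rewrite precompactE => cA.
apply: le_lt_trans (haar_compact theta_haar cA); apply: le_measure.
- exact/mem_set.
- by apply: mem_set; apply: closed_borel; exact: closed_closure.
- exact: subset_closure.
Qed.

Let fineK_A n : ((a n)%:E = theta (A n))%E.
Proof. by rewrite fineK// ge0_fin_numE// van_hove_fin. Qed.

Let a_gt0 n : 0 < a n.
Proof. by rewrite -lte_fin fineK_A (van_hove_gt0 A_van_hove). Qed.

Let a_ge0 n : 0 <= a n.
Proof. exact: ltW. Qed.

Let shift_integrable n x u : bounded_measurable u ->
  theta.-integrable (A n) (EFin \o (fun t => u (x + t))).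
Proof.
move=> bu; apply: bounded_measurable_integrable => //; first exact: van_hove_fin.
exact: bounded_measurable_shift.
Qed.

(** The translation is put on the function, not on the set, so that averages at all [x] are
    integrals over the same [A n]. *)
Definition average n x u : R :=
  Rintegral theta (A n) (fun t => u (x + t)) / a n.

Lemma averageD n x u v : bounded_measurable u -> bounded_measurable v ->
  average n x (fun t => u t + v t) = average n x u + average n x v.
Proof.
by move=> bu bv; rewrite /average RintegralD ?mulrDl//; exact: shift_integrable.
Qed.

Lemma averageZ n x (c : R) u : bounded_measurable u ->
  average n x (fun t => c * u t) = c * average n x u.
Proof.
by move=> bu; rewrite /average RintegralZl ?mulrA//; exact: shift_integrable.
Qed.

Lemma average_cst n x (c : R) : average n x (fun=> c) = c.
Proof. by rewrite /average Rintegral_cst// mulfK// gt_eqF. Qed.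

Lemma averageB n x u v : bounded_measurable u -> bounded_measurable v ->
  average n x (fun t => u t - v t) = average n x u - average n x v.
Proof.
by move=> bu bv; rewrite /average RintegralB ?mulrBl//; exact: shift_integrable.
Qed.

Lemma ler_average n x u v : bounded_measurable u -> bounded_measurable v ->
  (forall t, u t <= v t) -> average n x u <= average n x v.
Proof.
move=> bu bv uv; rewrite /average ler_wpM2r ?invr_ge0//.
by apply: le_Rintegral => //; exact: shift_integrable.
Qed.

Lemma ler_dist_average n x u v (e : R) :
  bounded_measurable u -> bounded_measurable v ->
  (forall t, `|u t - v t| <= e) -> `|average n x u - average n x v| <= e.
Proof.
move=> bu bv uve; rewrite -averageB//; have bd := bounded_measurableB bu bv.
rewrite ler_norml -{1}(average_cst n x (- e)) -{2}(average_cst n x e).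
by apply/andP; split; apply: ler_average => // [|t];
  try exact: bounded_measurable_cst; have := uve t; rewrite ler_norml => /andP[].
Qed.

(** Links the extended-real quotients inside [weyl_norm] to real averages. *)
Lemma Weyl_average n x u : bounded_measurable u -> (forall t, 0 <= u t) ->
  ((\int[theta]_(t in translate x (A n)) (u t)%:E) / theta (A n)
   = (average n x u)%:E)%E.
Proof.
move=> bu u0; have [mu _] := bu.
have mEu : measurable_fun [set: borel G] (EFin \o u : borel G -> \bar R).
  exact/measurable_EFinP.
have Eu0 t : (0 <= (EFin \o u) t)%E by rewrite lee_fin.
rewrite (integral_translate theta_haar x (measurable_A n) mEu Eu0).
rewrite -fineK_A inver gt_eqF// EFinM; congr (_ * _)%E.
by rewrite fineK//; apply: integrable_fin_num => //; exact: shift_integrable.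
Qed.

(** Both differences lie in the van Hove boundary of [A n] for the compact set consisting of [s] and
    [- s]. *)
Lemma van_hove_symmetric_difference s (e : R) : 0 < e ->
  \forall n \near \oo,
    fine (theta (translate s (A n) `\` A n)) <= e * a n /\
    fine (theta (A n `\` translate s (A n))) <= e * a n.
Proof.
move=> e0; (* s controls (s + A) \ A, and - s controls A \ (s + A). *)
pose K := [set s] `|` [set - s].
have cK : compact K by apply: compactU; exact: compact_set1.
have /fine_cvgP[finq] := van_hove_cvg A_van_hove cK.
move/cvgr0Pnorm_lt => /(_ e e0); apply: filterS2 finq => n /= finq lte.
have mb : measurable (van_hove_boundary K (A n) : set (borel G)).
  by apply: measurableU; apply: measurableI;
    apply: closed_borel; exact: closed_closure.
(* Since [fine] sends infinity to 0, a bound on the real quotient controls the boundary only once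
   its measure is known to be finite. An infinite measure would make the quotient infinite, against
   [finq]. *)
have bfin : theta (van_hove_boundary K (A n)) \is a fin_num.
  move: finq; rewrite -fineK_A inver gt_eqF//.
  rewrite ge0_fin_numE ?mule_ge0 ?lee_fin ?invr_ge0//.
  rewrite ge0_fin_numE// !ltey; apply: contra => /eqP ->.
  by rewrite gt0_mulye// lte_fin invr_gt0.
have be : fine (theta (van_hove_boundary K (A n))) <= e * a n.
  move: lte; rewrite -fineK_A inver gt_eqF// fineM// => /ltW.
  by rewrite normrM normfV !ger0_norm ?fine_ge0// ler_pdivrMr.
have sub (D : set G) : measurable (D : set (borel G)) ->
    D `<=` van_hove_boundary K (A n) -> fine (theta D) <= e * a n.
  move=> mD DB; apply: le_trans be.
  have DBle : (theta D <= theta (van_hove_boundary K (A n)))%E.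
    by apply: le_measure => //; exact/mem_set.
  rewrite fine_le// ge0_fin_numE//; apply: le_lt_trans DBle _.
  by rewrite -ge0_fin_numE.
have mT := measurable_translate s (measurable_A n).
split; apply: sub; try exact: measurableD.
- move=> _ [[t At <-] nA]; left; split; apply: subset_closure => //.
  by exists t => //; exists s; [left|rewrite addrC].
- move=> t [At nA]; right; split; apply: subset_closure => //.
  exists (t - s).
    by move=> Ats; apply: nA; exists (t - s) => //; rewrite addrC subrK.
  by exists (- s); [right|rewrite opprK subrK].
Qed.

Lemma ler_norm_Rintegral (D : set G) u (M : R) :
  measurable (D : set (borel G)) -> (theta D < +oo)%E ->
  bounded_measurable u -> (forall t, `|u t| <= M) ->
  `|Rintegral theta D u| <= M * fine (theta D).
Proof.
move=> mD Dfin bu uM; rewrite -Rintegral_cst//.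
have iu := bounded_measurable_integrable mD Dfin bu.
apply: le_trans (le_normr_Rintegral mD iu) _; apply: le_Rintegral => //.
  exact: (bounded_measurable_integrable mD Dfin (bounded_measurable_norm bu)).
exact: (bounded_measurable_integrable mD Dfin (bounded_measurable_cst _ M)).
Qed.

(** The integrals over [s + A n] and [A n] agree on the intersection and cancel there. What remains
    is at most a bound of [u] times the measure of the symmetric difference. *)
Lemma average_shift_cvg s u : bounded_measurable u ->
  average n s u - average n 0 u @[n --> \oo] --> (0 : R).
Proof.
move=> bu; have [_ [M0 uM0]] := bu; pose M := `|M0| + 1.
(* The added 1 makes [M] strictly positive, so that dividing [e] by it is legitimate. The other
   factor 2 accounts for the two set differences. *)
have M_gt0 : 0 < M by rewrite ltr_wpDl.
have uM t : `|u t| <= M.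
  by rewrite (le_trans (uM0 t))// (le_trans (ler_norm _))// lerDl.
apply/cvgr0Pnorm_le => e e0.
have e'0 : 0 < e / M / 2 by rewrite !divr_gt0.
apply: filterS (van_hove_symmetric_difference s e'0) => n [d1 d2].
have mA := measurable_A n; have Afin := van_hove_fin n.
have mT := measurable_translate s mA.
have Tfin : (theta (translate s (A n)) < +oo)%E.
  by rewrite (haar_invariant theta_haar).
have split_int (B C : set G) : measurable (B : set (borel G)) ->
    measurable (C : set (borel G)) -> (theta B < +oo)%E ->
    Rintegral theta B u =
    Rintegral theta (B `\` C) u + Rintegral theta (B `&` C) u.
  move=> mB mC Bfin; rewrite -[in LHS](setUIDK B C) setUC Rintegral_setU//.
  + exact: measurableD.
  + exact: measurableI.
  + by rewrite setUC setUIDK; exact: bounded_measurable_integrable.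
  + by apply/disj_setPS; rewrite setDE => t [[_ nC] [_ /nC]].
have finD (B C : set G) : measurable (B : set (borel G)) ->
    measurable (C : set (borel G)) -> (theta B < +oo)%E ->
    (theta (B `\` C) < +oo)%E.
  move=> mB mC; apply: le_lt_trans; apply: le_measure; rewrite ?inE//.
  exact: measurableD.
rewrite /average -(Rintegral_translate theta_haar)//.
under [X in _ - X / _]eq_Rintegral do rewrite add0r.
rewrite -mulrBl (split_int _ (A n))// (split_int (A n) (translate s (A n)))//.
rewrite [X in _ - (_ + X)](_ : _ = Rintegral theta (translate s (A n) `&` A n) u);
  last by rewrite setIC.
rewrite opprD addrACA subrr addr0 normrM normfV (gtr0_norm (a_gt0 n)) ler_pdivrMr//.
apply: le_trans (ler_normB _ _) _.
have h1 : `|Rintegral theta (translate s (A n) `\` A n) u| <= e / 2 * a n.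
  apply: le_trans (ler_norm_Rintegral _ (finD _ _ mT mA Tfin) bu uM) _.
    exact: measurableD.
  rewrite (le_trans (ler_wpM2l (ltW M_gt0) d1))//.
  by rewrite le_eqVlt; apply/orP; left; apply/eqP; field; rewrite gt_eqF.
have h2 : `|Rintegral theta (A n `\` translate s (A n)) u| <= e / 2 * a n.
  apply: le_trans (ler_norm_Rintegral _ (finD _ _ mA mT Afin) bu uM) _.
    exact: measurableD.
  rewrite (le_trans (ler_wpM2l (ltW M_gt0) d2))//.
  by rewrite le_eqVlt; apply/orP; left; apply/eqP; field; rewrite gt_eqF.
by rewrite (le_trans (lerD h1 h2))// -mulrDl -splitr.
Qed.

End Averages.

(** * Means that are uniform in the translation *)

Section UniformMean.
Variables (R : realType) (G : topologicalZmodType).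
Variable theta : {measure set (borel G) -> \bar R}.
Hypothesis theta_haar : haar_measure theta.
Variable A : nat -> set G.
Hypothesis A_van_hove : van_hove theta A.
Implicit Types (u v : G -> R) (f P chi : G -> R[i]).

Local Notation average := (average theta A).

(** The rank [n] is chosen before [x]: this uniformity matches the supremum over translates in the
    Weyl seminorm. *)
Definition uniform_mean u (c : R) : Prop :=
  bounded_measurable u /\
  forall e, 0 < e -> \forall n \near \oo, forall x, `|average n x u - c| <= e.

Lemma uniform_mean_cst (c : R) : uniform_mean (fun=> c) c.
Proof.
split; first exact: bounded_measurable_cst.
by move=> e e0; apply: nearW => n x; rewrite average_cst// subrr normr0 ltW.
Qed.

Lemma uniform_meanD u v (c d : R) : uniform_mean u c -> uniform_mean v d ->
  uniform_mean (fun t => u t + v t) (c + d).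
Proof.
move=> [bu uc] [bv vd]; split; first exact: bounded_measurableD.
move=> e e0; have e2 : 0 < e / 2 by rewrite divr_gt0.
apply: filterS2 (uc _ e2) (vd _ e2) => n un vn x.
rewrite averageD// opprD addrACA (le_trans (ler_normD _ _))//.
by rewrite [leRHS]splitr lerD.
Qed.

Lemma uniform_meanZ (k : R) u (c : R) : uniform_mean u c ->
  uniform_mean (fun t => k * u t) (k * c).
Proof.
move=> [bu uc]; split; first exact: bounded_measurableZ.
(* Adding 1 covers the case [k = 0]. *)
move=> e e0; have k0 : 0 < `|k| + 1 by rewrite ltr_wpDl.
apply: filterS (uc _ (divr_gt0 e0 k0)) => n un x.
rewrite averageZ// -mulrBr normrM.
rewrite (le_trans (ler_wpM2l (normr_ge0 k) (un x)))//.
by rewrite mulrCA ler_piMr 1?ltW// ltr_pdivrMr// mul1r ltrDl.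
Qed.

Lemma uniform_mean_cvg u (c : R) : uniform_mean u c ->
  average n 0 u @[n --> \oo] --> c.
Proof.
move=> [bu uc]; apply/cvgrPdist_le => e e0.
by apply: filterS (uc _ e0) => n /(_ 0); rewrite distrC.
Qed.

Lemma mean_uniform_mean u (c : R) : uniform_mean u c -> mean theta A u = c.
Proof.
move=> /uniform_mean_cvg uc; apply: cvg_lim => //.
rewrite (_ : (fun n => _) = fun n => average n 0 u)//.
by apply/funext => n; congr (_ / _); apply: eq_Rintegral => t _; rewrite add0r.
Qed.

(** The means of the approximants need not be compared with one another: each of them eventually
    lies close to all averages of [u], which makes the averages at 0 a Cauchy sequence. *)
Lemma uniform_mean_approx u : bounded_measurable u ->
  (forall e, 0 < e -> exists v c, uniform_mean v c /\
     forall t, `|u t - v t| <= e) -> exists c, uniform_mean u c.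
Proof.
move=> bu ap.
have app e : 0 < e -> exists c, \forall n \near \oo, forall x,
    `|average n x u - c| <= e.
  move=> e0; have e2 : 0 < e / 2 by rewrite divr_gt0.
  have [v [c [[bv vc] uv]]] := ap _ e2; exists c.
  apply: filterS (vc _ e2) => n vn x.
  rewrite -(subrKA (average n x v)) (le_trans (ler_normD _ _))//.
  by rewrite [leRHS]splitr lerD//; exact: ler_dist_average.
(* The limit of the averages at x = 0 is the uniform mean. *)
have /cauchy_cvgP/cvg_ex[c cu] : cauchy (average n 0 u @[n --> \oo]).
  apply: cauchy_exP => e e0; have e2 : 0 < e / 2 by rewrite divr_gt0.
  have [c cP] := app _ e2; exists c; apply: filterS cP => n /(_ 0).
  rewrite /ball/= distrC => /le_lt_trans; apply.
  by rewrite ltr_pdivrMr// ltr_pMr// ltr1n.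
exists c; split=> // e e0; have e2 : 0 < e / 2 by rewrite divr_gt0.
(* Eventually [d] is within [e / 2] of the averages at every [x], hence also of the limit [c] of
   those at 0. *)
have [d dP] := app _ e2; apply: filterS (dP) => n dn x.
rewrite -(subrKA d) (le_trans (ler_normD _ _))// [leRHS]splitr lerD//.
rewrite distrC.
have /cvg_norm cvd : average n 0 u - d @[n --> \oo] --> c - d.
  by apply: cvgB cu _; exact: cvg_cst.
by apply: (cvgr_to_le cvd); apply: filterS dP => m; exact.
Qed.

Definition cuniform_mean f : Prop :=
  (exists c, uniform_mean (fun t => complex.Re (f t)) c) /\
  (exists c, uniform_mean (fun t => complex.Im (f t)) c).

(** The trivial character has mean 1. Otherwise [chi s] differs from 1 for some [s]; the average at
    [s] is [chi s] times the average at 0, and their difference tends to 0, so the average at 0 does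
    too. The average at [x] has the same modulus as the one at 0, whence uniformity. *)
Lemma character_uniform_mean chi : character chi -> cuniform_mean chi.
Proof.
move=> [cchi mchi achi]; have [mre mim] := ccontinuous_measurable cchi.
have bre : bounded_measurable (fun t => complex.Re (chi t)).
  by split=> //; exists 1 => t; rewrite -(mchi t) ler_Re_modulus.
have bim : bounded_measurable (fun t => complex.Im (chi t)).
  by split=> //; exists 1 => t; rewrite -(mchi t) ler_Im_modulus.
have [triv|/existsNP[s chis]] := pselect (forall s, chi s = 1).
  split; [exists 1|exists 0].
    rewrite (_ : (fun _ => _) = fun=> 1); first exact: uniform_mean_cst.
    by apply/funext => t; rewrite triv.
  rewrite (_ : (fun _ => _) = fun=> 0); first exact: uniform_mean_cst.
  by apply/funext => t; rewrite triv.
pose p n := average n 0 (fun t => complex.Re (chi t)).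
pose q n := average n 0 (fun t => complex.Im (chi t)).
(* This and [avim] are the real and imaginary parts of the rule that the average at [x] is [chi x]
   times [p n + i q n]. *)
have avre n x : average n x (fun t => complex.Re (chi t)) =
    complex.Re (chi x) * p n - complex.Im (chi x) * q n.
  rewrite /p /q -!averageZ// -averageB//; try exact: bounded_measurableZ.
  congr (_ / _); apply: eq_Rintegral => t _; rewrite !add0r achi.
  by case: (chi x) (chi t) => ? ? [].
have avim n x : average n x (fun t => complex.Im (chi t)) =
    complex.Re (chi x) * q n + complex.Im (chi x) * p n.
  rewrite /p /q -!averageZ// -averageD//; try exact: bounded_measurableZ.
  congr (_ / _); apply: eq_Rintegral => t _; rewrite !add0r achi.
  by case: (chi x) (chi t) => ? ? [].
have [p0 q0] : p n @[n --> \oo] --> 0 /\ q n @[n --> \oo] --> 0.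
  pose a := complex.Re (chi s) - 1; pose b := complex.Im (chi s).
  have d0 : a ^+ 2 + b ^+ 2 != 0.
    rewrite paddr_eq0 ?sqr_ge0// !sqrf_eq0 subr_eq0; apply/negP => /andP[/eqP ra].
    move=> /eqP ib; apply: chis; move: ra ib; rewrite /b.
    by case: (chi s) => ? ? /= -> ->.
  (* e + i e' = (chi s - 1) (p + i q), where p + i q is the average of chi. *)
  pose e n := a * p n - b * q n; pose e' n := a * q n + b * p n.
  have e_cvg : e n @[n --> \oo] --> 0.
    have := average_shift_cvg theta_haar A_van_hove s bre.
    rewrite (_ : (fun n => _ - _) = e)//; apply/funext => n.
    by rewrite avre /e /a /b -/(p n); ring.
  have e'_cvg : e' n @[n --> \oo] --> 0.
    have := average_shift_cvg theta_haar A_van_hove s bim.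
    rewrite (_ : (fun n => _ - _) = e')//; apply/funext => n.
    by rewrite avim /e' /a /b -/(q n); ring.
  split.
    (* Division by [chi s - 1 = a + i b], as multiplication by its conjugate over its squared
       modulus; [q] is the imaginary part. *)
    rewrite (_ : p = fun n => (a * e n + b * e' n) / (a ^+ 2 + b ^+ 2)).
      have := cvgM (cvgD (cvgM (cvg_cst a) e_cvg) (cvgM (cvg_cst b) e'_cvg))
        (cvg_cst (a ^+ 2 + b ^+ 2)^-1).
      by rewrite !mulr0 addr0 mul0r; apply.
    by apply/funext => n; rewrite /e /e'; field.
  rewrite (_ : q = fun n => (a * e' n - b * e n) / (a ^+ 2 + b ^+ 2)).
    have := cvgM (cvgB (cvgM (cvg_cst a) e'_cvg) (cvgM (cvg_cst b) e_cvg))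
      (cvg_cst (a ^+ 2 + b ^+ 2)^-1).
    by rewrite !mulr0 subr0 mul0r; apply.
  by apply/funext => n; rewrite /e /e'; field.
(* As [chi x] has modulus 1, the bound does not depend on [x]. *)
have le1 x (r s' : R) : `|complex.Re (chi x) * r| + `|complex.Im (chi x) * s'|
    <= `|r| + `|s'|.
  by rewrite lerD// normrM ler_piMl// -(mchi x) ?ler_Re_modulus ?ler_Im_modulus.
split; exists 0; split=> // e e0; have e2 : 0 < e / 2 by rewrite divr_gt0.
- move/cvgr0Pnorm_le : p0 => /(_ _ e2); move/cvgr0Pnorm_le : q0 => /(_ _ e2).
  apply: filterS2 => n qn pn x; rewrite subr0 avre.
  rewrite (le_trans (ler_normB _ _))// (le_trans (le1 _ _ _))//.
  by rewrite [leRHS]splitr lerD.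
- move/cvgr0Pnorm_le : p0 => /(_ _ e2); move/cvgr0Pnorm_le : q0 => /(_ _ e2).
  apply: filterS2 => n qn pn x; rewrite subr0 avim.
  rewrite (le_trans (ler_normD _ _))// (le_trans (le1 _ _ _))//.
  by rewrite [leRHS]splitr lerD.
Qed.

Lemma cuniform_meanD f P : cuniform_mean f -> cuniform_mean P ->
  cuniform_mean (fun t => f t + P t).
Proof.
move=> [[c fc] [d fd]] [[c' Pc] [d' Pd]]; split.
  by exists (c + c'); under eq_fun do rewrite raddfD; exact: uniform_meanD.
by exists (d + d'); under eq_fun do rewrite raddfD; exact: uniform_meanD.
Qed.

Lemma cuniform_meanZ (k : R[i]) f : cuniform_mean f ->
  cuniform_mean (fun t => k * f t).
Proof.
case: k => k l [[c fc] [d fd]]; split.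
  exists (k * c + (- l) * d).
  rewrite (_ : (fun _ => _) = fun t => k * complex.Re (f t)
    + (- l) * complex.Im (f t)).
    by apply: uniform_meanD; exact: uniform_meanZ.
  by apply/funext => t; case: (f t) => ? ? /=; rewrite mulNr.
exists (k * d + l * c).
rewrite (_ : (fun _ => _) = fun t => k * complex.Im (f t)
  + l * complex.Re (f t)).
  by apply: uniform_meanD; exact: uniform_meanZ.
by apply/funext => t; case: (f t).
Qed.

Lemma trig_poly_uniform_mean P : trig_poly P -> cuniform_mean P.
Proof.
move=> [n [c [chi [chichar /funext ->]]]].
elim: n c chi chichar => [|n ih] c chi chichar.
  by split; exists 0; under eq_fun do rewrite big_ord0; exact: uniform_mean_cst.
under eq_fun do rewrite big_ord_recr/=; apply: cuniform_meanD.
  exact: (ih (fun i => c (widen_ord (leqnSn n) i))).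
exact/cuniform_meanZ/character_uniform_mean.
Qed.

Lemma cuniform_mean_measurable f : cuniform_mean f -> cmeasurable f.
Proof. by move=> [[c [[mr _] _]] [d [[mi _] _]]]. Qed.

Lemma cuniform_mean_bounded f : cuniform_mean f ->
  exists M, forall t, modulus (f t) <= M.
Proof.
move=> [[c [[_ [M fM]] _]] [d [[_ [N fN]] _]]]; exists (M + N) => t.
by rewrite (le_trans (ler_modulus_ReIm _))// lerD.
Qed.

(** Real parts of trigonometric polynomials approximate [u] uniformly and have uniform means.
    Boundedness comes from one approximant at distance 1, measurability from a sequence of them. *)
Lemma real_bohr_ap_uniform_mean u : real_bohr_ap u -> exists c, uniform_mean u c.
Proof.
move=> bohr_u.
have ap e : 0 < e -> exists v c, uniform_mean v c /\
    forall t, `|u t - v t| <= e.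
  move=> e0; have [P /trig_poly_uniform_mean[[c Pc] _] uP] := bohr_u e e0.
  exists (fun t => complex.Re (P t)), c; split => // t.
  by rewrite (le_trans _ (uP t))// (le_trans _ (ler_Re_modulus _))// raddfB.
apply: (uniform_mean_approx _ ap); split; last first.
  have [v [c [[[_ [M vM]] _] uv]]] := ap 1 ltr01; exists (1 + M) => t.
  by rewrite -(subrK (v t) (u t)) (le_trans (ler_normD _ _))// lerD.
(* Approximants within [1 / (k + 1)] converge pointwise to [u], and a pointwise limit of measurable
   functions is measurable. *)
have inv_gt0 k : 0 < (k.+1%:R^-1 : R) by rewrite invr_gt0.
pose v k := projT1 (cid (ap _ (inv_gt0 k))).
have vP k := projT2 (cid (ap _ (inv_gt0 k))).
apply: (@measurable_fun_cvg _ _ _ _ (fun k => v k : borel G -> R)).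
  by move=> k; have [c [[[]]]] := vP k.
move=> t _; apply/cvgrPdist_le => e e0.
near=> k; have [c [_ /(_ t) uv]] := vP k; apply: le_trans uv _.
by apply: ltW; near: k; exact: (near_infty_natSinv_lt (PosNum e0)).
Unshelve. all: by end_near. Qed.

End UniformMean.

(** * Linear combinations of trigonometric polynomials *)

Section TrigonometricPolynomials.
Variables (R : realType) (G : topologicalZmodType).
Implicit Types P Q : G -> R[i].

Lemma trig_polyD P Q : trig_poly P -> trig_poly Q ->
  trig_poly (fun t => P t + Q t).
Proof.
move=> [m [c [chi [chichar PE]]]] [n [d [psi [psichar QE]]]].
exists (m + n)%N,
  (fun i => match fintype.split i with inl j => c j | inr j => d j end),
  (fun i => match fintype.split i with inl j => chi j | inr j => psi j end).
split=> [i|t]; first by case: splitP.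
rewrite PE QE big_split_ord/=; congr (_ + _); apply: eq_bigr => i _.
  by rewrite (unsplitK (inl i)).
by rewrite (unsplitK (inr i)).
Qed.

Lemma trig_polyZ (k : R[i]) P : trig_poly P -> trig_poly (fun t => k * P t).
Proof.
move=> [m [c [chi [chichar PE]]]]; exists m, (fun i => k * c i), chi.
by split=> // t; rewrite PE mulr_sumr; apply: eq_bigr => i _; rewrite mulrA.
Qed.

End TrigonometricPolynomials.

(** * From Meyer to Weyl almost periodicity *)

Section Meyer.
Variables (R : realType) (G : topologicalZmodType).
Variable theta : {measure set (borel G) -> \bar R}.
Hypothesis theta_haar : haar_measure theta.
Variable A : nat -> set G.
Hypothesis A_van_hove : van_hove theta A.
Implicit Types (u v : G -> R) (f P h : G -> R[i]).

Local Notation average := (average theta A).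
Local Notation uniform_mean := (uniform_mean theta A).

Lemma bounded_measurable_modulus f : cmeasurable f ->
  (exists M, forall t, modulus (f t) <= M) ->
  bounded_measurable (fun t => modulus (f t)).
Proof.
move=> mf [M fM]; split; first exact: cmeasurable_modulus.
by exists M => t; rewrite ger0_norm ?modulus_ge0.
Qed.

(** The limit superior is an infimum, over eventual sets of indices, of suprema. The set of [n]
    where the bound holds is one candidate; conversely, [weyl_norm_lt] extracts such a set from a
    strict bound. *)
Lemma weyl_norm_le f (d : R) : bounded_measurable (fun t => modulus (f t)) ->
  (\forall n \near \oo, forall x, average n x (fun t => modulus (f t)) <= d) ->
  (weyl_norm theta A f <= d%:E)%E.
Proof.
move=> bf fd; rewrite /weyl_norm /limn_esup limf_esupE.
apply: le_trans (ereal_inf_lbound _) _; first by eexists; [exact: fd|].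
apply: ge_ereal_sup => _ [n /= nd <-]; apply: ge_ereal_sup => _ [x _ <-].
rewrite (Weyl_average theta_haar)// ?lee_fin//.
by move=> t; exact: modulus_ge0.
Qed.

Lemma weyl_norm_lt f (d : R) : bounded_measurable (fun t => modulus (f t)) ->
  (weyl_norm theta A f < d%:E)%E ->
  \forall n \near \oo, forall x, average n x (fun t => modulus (f t)) <= d.
Proof.
move=> bf; rewrite /weyl_norm /limn_esup limf_esupE.
move=> /ereal_inf_lt[_ [V FV <-] Vd]; apply: filterS FV => n Vn x.
rewrite -lee_fin -(Weyl_average theta_haar)//; last first.
  by move=> t; exact: modulus_ge0.
apply: le_trans (ltW Vd).
apply: le_trans (ereal_sup_ubound _); last by exists n.
by apply: ereal_sup_ubound; exists x.
Qed.

(** With [g <= u <= h], take [k = h - g]. The [mean] in the definition of [real_gap] then equals the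
    uniform mean of [k], so its smallness holds for averages at every [x]. *)
Lemma real_gap_approx u (e : R) : real_gap theta A u -> 0 < e ->
  exists g k c, [/\ real_bohr_ap g, uniform_mean k c, c < e &
    forall t, `|u t - g t| <= k t].
Proof.
move=> [_ gapu] e0; have [g [h [bg bh guh mhg]]] := gapu e e0.
have [c gc] := real_bohr_ap_uniform_mean theta_haar A_van_hove bg.
have [d hd] := real_bohr_ap_uniform_mean theta_haar A_van_hove bh.
have hgm : uniform_mean (fun t => h t - g t) (d - c).
  under eq_fun do rewrite -mulN1r; rewrite -(mulN1r c).
  by apply: uniform_meanD => //; exact: uniform_meanZ.
exists g, (fun t => h t - g t), (d - c); split => //.
  by rewrite -(mean_uniform_mean hgm).
by move=> t; have /andP[gu uh] := guh t; rewrite ger0_norm ?subr_ge0// lerB.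
Qed.

Lemma real_gap_bounded_measurable u : real_gap theta A u -> bounded_measurable u.
Proof.
move=> gapu; split; first by have [] := gapu.
have [g [k [c [bg [[_ [M kM]] _] _ ugk]]]] := real_gap_approx gapu ltr01.
have [d [[_ [N gN]] _]] := real_bohr_ap_uniform_mean theta_haar A_van_hove bg.
exists (M + N) => t; rewrite -(subrK (g t) (u t)) (le_trans (ler_normD _ _))//.
by rewrite lerD// (le_trans (ugk t))// (le_trans (ler_norm _)).
Qed.

Lemma meyer_ap_measurable f : meyer_ap theta A f -> cmeasurable f.
Proof.
move=> [g [h [/funext -> [[gr _] [gi _]] mh _ _]]].
exact: cmeasurableD.
Qed.

Lemma meyer_ap_bounded f : meyer_ap theta A f ->
  exists M, forall t, modulus (f t) <= M.
Proof.
move=> [g [h [fE [/real_gap_bounded_measurable[_ [M gM]]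
  /real_gap_bounded_measurable[_ [N gN]]] _ [L hL] _]]].
exists (M + N + L) => t; rewrite fE (le_trans (ler_modulusD _ _))// lerD//.
by rewrite (le_trans (ler_modulus_ReIm _))// lerD.
Qed.

(** In a Hausdorff space compact sets are closed, hence Borel, and Haar measure is finite on
    them. *)
Lemma bounded_L1_loc f : hausdorff_space G -> cmeasurable f ->
  (exists M, forall t, modulus (f t) <= M) -> L1_loc theta f.
Proof.
move=> hG mf bf; split=> // K cK.
have mK : measurable (K : set (borel G)).
  by apply: closed_borel; exact: compact_closed.
have /integrableP[_] := bounded_measurable_integrable mK
  (haar_compact theta_haar cK) (bounded_measurable_modulus mf bf).
by under eq_integral do rewrite /= ger0_norm ?modulus_ge0//.
Qed.

Lemma meyer_ap_weyl_ap f : hausdorff_space G -> meyer_ap theta A f ->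
  weyl_ap theta A f.
Proof.
move=> hG mapf; have mf := meyer_ap_measurable mapf.
have bf := meyer_ap_bounded mapf.
split; first exact: bounded_L1_loc.
(* Error budget: each [k1], [k2] has mean below [e] and averages within [e] of it, giving [2 * e]
   apiece; the two uniform approximations cost [2 * e] and [h] costs [e]. The total [7 * e] is less
   than [eps]. *)
move=> eps eps0; pose e := eps / 8%:R; have e0 : 0 < e by rewrite divr_gt0.
have [g [h [fE [gapr gapi] mh bh wh]]] := mapf.
have [g1 [k1 [c1 [bg1 k1c ec1 gk1]]]] := real_gap_approx gapr e0.
have [g2 [k2 [c2 [bg2 k2c ec2 gk2]]]] := real_gap_approx gapi e0.
have [P1 tP1 gP1] := bg1 e e0; have [P2 tP2 gP2] := bg2 e e0.
(* [P1] and [P2] may take non-real values although they approximate real functions; this is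
   harmless, since only the modulus of the error counts. *)
pose P t := P1 t + 'i%C * P2 t.
have tP : trig_poly P by apply: trig_polyD => //; exact: trig_polyZ.
exists P => //.
have cP := trig_poly_uniform_mean theta_haar A_van_hove tP.
have bfP : bounded_measurable (fun t => modulus (f t - P t)).
  apply: bounded_measurable_modulus.
    have := cuniform_mean_measurable (cuniform_meanZ theta_haar A_van_hove (-1) cP).
    by move=> /(cmeasurableD mf); under eq_fun do rewrite mulN1r.
  have [M fM] := bf; have [N PN] := cuniform_mean_bounded cP.
  exists (M + N) => t; rewrite (le_trans (ler_modulusD _ _))// lerD//.
  by rewrite modulusN.
have bh' := bounded_measurable_modulus mh bh.
(* [f - P] splits into [g - (g1 + i g2)], bounded by [k1 + k2], then [(g1 - P1) + i (g2 - P2)],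
   bounded by [2 * e], and [h]. *)
have ptwise t : modulus (f t - P t) <=
    (k1 t + k2 t) + (2%:R * e + modulus (h t)).
  have -> : f t - P t = (Complex (complex.Re (g t) - g1 t) 0
      + 'i%C * Complex (complex.Im (g t) - g2 t) 0)
    + ((Complex (g1 t) 0 - P1 t + 'i%C * (Complex (g2 t) 0 - P2 t)) + h t).
    rewrite fE /P; case: (g t) (h t) (P1 t) (P2 t) => [a b] [? ?] [? ?] [? ?].
    by apply/eqP; rewrite eq_complex /=; apply/andP; split; apply/eqP; ring.
  have modr (r : R) : modulus (Complex r 0) = `|r|.
    by rewrite /= expr0n addr0 sqrtr_sqr.
  have modi (z : R[i]) : modulus ('i%C * z) = modulus z.
    by rewrite ComplexField.Normc.normcM /= expr0n expr1n add0r sqrtr1 mul1r.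
  apply: le_trans (ler_modulusD _ _) _; apply: lerD.
    by apply: le_trans (ler_modulusD _ _) _; rewrite modi !modr lerD.
  apply: le_trans (ler_modulusD _ _) _; rewrite lerD2r.
  apply: le_trans (ler_modulusD _ _) _; rewrite modi.
  by rewrite mulr_natl mulr2n lerD.
have [bk1 k1e] := k1c; have [bk2 k2e] := k2c.
have he : (weyl_norm theta A h < e%:E)%E by rewrite wh lte_fin.
apply: (@le_lt_trans _ _ (7%:R * e)%:E); last first.
  by rewrite lte_fin /e; lra.
apply: weyl_norm_le => //.
have h3e := weyl_norm_lt bh' he.
apply: filterS3 (k1e _ e0) (k2e _ e0) h3e => n h1 h2 h3 x.
have bcst := bounded_measurable_cst G (2%:R * e).
apply: le_trans (ler_average theta_haar A_van_hove n x bfP _ ptwise) _.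
  by apply: bounded_measurableD; exact: bounded_measurableD.
rewrite !averageD//; try exact: bounded_measurableD.
rewrite average_cst//.
move: (h1 x) (h2 x) (h3 x); rewrite !ler_norml => /andP[_ ?] /andP[_ ?] ?.
lra.
Qed.

End Meyer.

Theorem corollary5p33 (R : realType) (G : topologicalZmodType)
  (G_hausdorff : hausdorff_space G)
  (G_locally_compact : locally_compact [set: G])
  (G_sigma_compact : sigma_compact G)
  (theta : {measure set (borel G) -> \bar R})
  (theta_haar : haar_measure theta)
  (A : nat -> set G) (A_van_hove : van_hove theta A) :
  (forall f : G -> R[i], L1_loc theta f ->
     meyer_ap theta A f -> weyl_ap theta A f) /\
  (forall mu : (G -> R[i]) -> R[i], radon_measure mu ->
     translation_bounded mu ->
     meyer_ap_measure theta A mu -> weyl_ap_measure theta A mu).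
Proof.
have main f : meyer_ap theta A f -> weyl_ap theta A f.
  exact: meyer_ap_weyl_ap.
by split=> [f _|mu _ _ mapmu phi /mapmu]; exact: main.
Qed.
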